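(* Let $G$ be a second countable Hausdorff ample groupoid all of whose isotropy groups are virtually abelian, let $H$ be a discrete group, and let $K$ be an algebraically closed field of cardinality greater than $\dim_K A_K(G)$. If $A_K(G)$ is locally finite for an $H$-grading induced by a continuous cocycle $c:G\to H$, then $A_K(G)$ is a CCR algebra. In particular, if $G$ is a second countable Hausdorff ample groupoid all of whose isotropy groups are virtually abelian, $H$ is a discrete group, and $A_{\mathbb C}(G)$ is locally finite for an $H$-grading induced by a continuous cocycle $c:G\to H$, then $A_{\mathbb C}(G)$ is CCR.
   Context: An ample Hausdorff groupoid is a locally compact Hausdorff étale topological groupoid $G$ having a basis of compact open bisections, where a bisection is a set $U\subseteq G$ such that the range map $r$ and the source map $s$ restrict to bijections from $U$ onto $r(U)$ and $s(U)$. The isotropy group at a unit $u\in G^{(0)}$ is $G_u^u=\{\gamma\in G: r(\gamma)=s(\gamma)=u\}$. The Steinberg algebra is $A_K(G)=\mathrm{span}_K\{1_U: U\subseteq G\text{ a compact open bisection}\}$ with convolution product, determined by $1_U*1_V=1_{UV}$. A continuous cocycle (groupoid homomorphism) $c:G\to H$ into a discrete group induces the $H$-grading with components $A_K(G)_h=\mathrm{span}_K\{1_U: U\subseteq c^{-1}(h)\text{ a compact open bisection}\}$. The graded algebra is locally finite if every homogeneous component is finite-dimensional over $K$. The algebra $A_K(G)$ is CCR if all its irreducible representations over $K$ act by finite rank operators. *)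

(* Defs.v *)
From HB Require Import structures.
From mathcomp Require Import all_boot all_order all_algebra.
From mathcomp Require Import all_classical all_reals all_analysis.
From mathcomp Require Import complex.

Set Implicit Arguments.
Unset Strict Implicit.
Unset Printing Implicit Defensive.

Import Order.TTheory GRing.Theory Num.Theory.

Local Open Scope classical_set_scope.
Local Open Scope card_scope.
Local Open Scope ring_scope.

(* Arrows-only presentation: a unit is identified with its identity arrow, so
   the source and the range of an arrow are again arrows. [gmul x y] is the
   composite xy when [gsrc x = grng y]; its other values are unconstrained. *)
HB.mixin Record isGroupoid (G : Type) := {
  gsrc : G -> G;
  grng : G -> G;
  ginv : G -> G;
  gmul : G -> G -> G;
  gsrc_src : forall x, gsrc (gsrc x) = gsrc x;
  grng_src : forall x, grng (gsrc x) = gsrc x;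
  gsrc_rng : forall x, gsrc (grng x) = grng x;
  grng_rng : forall x, grng (grng x) = grng x;
  gsrc_mul : forall x y, gsrc x = grng y -> gsrc (gmul x y) = gsrc y;
  grng_mul : forall x y, gsrc x = grng y -> grng (gmul x y) = grng x;
  gmulA : forall x y z, gsrc x = grng y -> gsrc y = grng z ->
    gmul x (gmul y z) = gmul (gmul x y) z;
  gmul_rng : forall x, gmul (grng x) x = x;
  gmul_src : forall x, gmul x (gsrc x) = x;
  gsrc_inv : forall x, gsrc (ginv x) = grng x;
  grng_inv : forall x, grng (ginv x) = gsrc x;
  gmulV : forall x, gmul x (ginv x) = grng x;
  gmulVx : forall x, gmul (ginv x) x = gsrc x
}.

#[short(type="groupoidType")]
HB.structure Definition Groupoid := {G of isGroupoid G}.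

(* The compatibility of the two structures is [topological_groupoid] below. *)
#[short(type="groupoidTopType")]
HB.structure Definition GroupoidTop := {G of isGroupoid G & Topological G}.

Section LinearAlgebra.
Context {K : fieldType} {V : lmodType K}.

Definition linear_span (B : set V) : set V :=
  [set v | exists (n : nat) (a : 'I_n -> K) (e : 'I_n -> V),
    (forall i, B (e i)) /\ v = \sum_(i < n) a i *: e i].

Definition linearly_independent (B : set V) : Prop :=
  forall (n : nat) (a : 'I_n -> K) (e : 'I_n -> V),
    injective e -> (forall i, B (e i)) ->
    \sum_(i < n) a i *: e i = 0 -> forall i, a i = 0.

Definition linear_basis (B W : set V) : Prop :=
  linearly_independent B /\ linear_span B = W.

Definition finite_dimensional (W : set V) : Prop :=
  exists2 B, finite_set B & linear_basis B W.

(* [dim W < #|T|]; all bases of [W] have the same cardinality. *)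
Definition dim_lt_card (W : set V) (T : Type) : Prop :=
  exists2 B : set V, linear_basis B W &
    B #<= [set: T] /\ ~ ([set: T] #<= B).

End LinearAlgebra.

(* [f] as a map from [X] to the topological subspace [E] of [Y]. *)
Definition local_homeomorphism {X Y : topologicalType} (E : set Y)
    (f : X -> Y) : Prop :=
  set_fun [set: X] E f /\
  forall x, exists U : set X,
    [/\ open U, U x, open (f @` U : set (subspace E)) &
      exists g : Y -> X,
        [/\ set_bij U (f @` U) f, {within U, continuous f},
            {in U, cancel f g} & {within f @` U, continuous g}]].

Section Groupoids.
Context {G : groupoidType}.

Definition units : set G := [set u | grng u = u].

Definition isotropy (u : G) : set G := [set x | grng x = u /\ gsrc x = u].

Definition isotropy_subgroup (u : G) (N : set G) : Prop :=
  [/\ N `<=` isotropy u, N u,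
      forall x y, N x -> N y -> N (gmul x y) &
      forall x, N x -> N (ginv x)].

(* Finite index: the set of left cosets xN of N is finite. *)
Definition virtually_abelian_isotropy (u : G) : Prop :=
  exists N : set G,
    [/\ isotropy_subgroup u N,
        forall x y, N x -> N y -> gmul x y = gmul y x &
        finite_set [set gmul x @` N | x in isotropy u]].

Definition bisection (U : set G) : Prop :=
  set_bij U (grng @` U) grng /\ set_bij U (gsrc @` U) gsrc.

Definition gmul_set (U V : set G) : set G :=
  [set z | exists x y, [/\ U x, V y, gsrc x = grng y & z = gmul x y]].

Definition cocycle {H : groupType} (c : G -> H) : Prop :=
  forall x y, gsrc x = grng y -> c (gmul x y) = (c x * c y)%g.

End Groupoids.
Arguments units : clear implicits.

Section AmpleGroupoids.
Variable G : groupoidTopType.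

Definition topological_groupoid : Prop :=
  {within [set p : G * G | gsrc p.1 = grng p.2],
     continuous (fun p : G * G => gmul p.1 p.2)} /\
  continuous (@ginv G).

Definition etale : Prop :=
  local_homeomorphism (units G) (@grng G) /\
  local_homeomorphism (units G) (@gsrc G).

Definition compact_open_bisection (U : set G) : Prop :=
  [/\ compact U, open U & bisection U].

Definition ample_Hausdorff_groupoid : Prop :=
  [/\ topological_groupoid, hausdorff_space G, locally_compact [set: G],
      etale & basis compact_open_bisection].

End AmpleGroupoids.

Section SteinbergAlgebra.
Variables (K : fieldType) (G : groupoidTopType).

(* The algebra A_K(G), as a subspace of the space of all functions G -> K. *)
Definition steinberg_algebra : set (G -> K^o) :=
  linear_span [set (\1_U : G -> K^o) | U in compact_open_bisection (G := G)].

Definition steinberg_component (H : groupType) (c : G -> H) (h : H) :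
    set (G -> K^o) :=
  linear_span [set (\1_U : G -> K^o) | U in
    [set U | compact_open_bisection U /\ U `<=` c @^-1` [set h]]].

Definition locally_finite (H : groupType) (c : G -> H) : Prop :=
  forall h, finite_dimensional (steinberg_component c h).

(* (f * g)(x) is the sum of f(y) g(z) over all factorizations x = yz, for which
   z = y^-1 x. For f and g in A_K(G) the sum has finite support. *)
Definition convolution (f g : G -> K^o) : G -> K^o := fun x =>
  \sum_(y \in [set y | grng y = grng x]) (f y * g (gmul (ginv y) x)).

(* A representation on M is a map of A_K(G) to End_K(M); the values of [rho]
   outside A_K(G) play no role. *)
Definition representation (M : lmodType K)
    (rho : (G -> K^o) -> M -> M) : Prop :=
  [/\ forall f, steinberg_algebra f -> linear (rho f),
      forall (k : K) f g m, steinberg_algebra f -> steinberg_algebra g ->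
        rho (k *: f + g) m = k *: rho f m + rho g m &
      forall f g m, steinberg_algebra f -> steinberg_algebra g ->
        rho (convolution f g) m = rho f (rho g m)].

(* A_K(G) need not be unital: irreducible means AM <> 0 and no invariant
   subspaces other than 0 and M. *)
Definition irreducible_representation (M : lmodType K)
    (rho : (G -> K^o) -> M -> M) : Prop :=
  [/\ representation rho,
      exists f m, steinberg_algebra f /\ rho f m <> 0 &
      forall W : {pred M}, submod_closed W ->
        (forall f, steinberg_algebra f -> {in W, forall m, rho f m \in W}) ->
        W =i pred1 0 \/ W =i predT].

Definition CCR : Prop :=
  forall (M : lmodType K) (rho : (G -> K^o) -> M -> M),
    irreducible_representation rho ->
    forall f, steinberg_algebra f -> finite_dimensional (range (rho f)).

Lemma convolution_indic (U V : set G) : bisection U ->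
  convolution \1_U \1_V = \1_(gmul_set U V).
Proof.
move=> [[_ rinj _] _]; apply/funext => x; rewrite /convolution.
have [[y [z [Uy Vz yz xE]]]|nUV] := pselect (gmul_set U V x).
  have rx : grng x = grng y by rewrite xE grng_mul.
  have zE : gmul (ginv y) x = z.
    by rewrite xE gmulA ?gsrc_inv // gmulVx yz gmul_rng.
  rewrite -(fsbig_widen [set y]) /=.
  - by rewrite fsbig_set1 zE !indicE !mem_set ?mulr1 //; exists y, z.
  - by move=> _ ->.
  - move=> t [/= rt ty]; rewrite indicE memNset ?mul0r // => Ut.
    by apply: ty; apply: rinj; rewrite ?rt //; exact: mem_set.
rewrite indicE memNset // fsbig1 // => y /= ry; rewrite !indicE.
have [Uy|nUy] := pselect (U y); last by rewrite (memNset nUy) mul0r.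
have [Vy|nVy] := pselect (V (gmul (ginv y) x)); last first.
  by rewrite (memNset nVy) mulr0.
case: nUV; exists y, (gmul (ginv y) x).
have yx : gsrc (ginv y) = grng x by rewrite gsrc_inv.
split=> //; first by rewrite grng_mul // grng_inv.
by rewrite gmulA ?grng_inv // gmulV ry gmul_rng.
Qed.

End SteinbergAlgebra.
Arguments steinberg_algebra : clear implicits.

(* Main.v *)
Require Import Defs.
From HB Require Import structures.
From mathcomp Require Import all_boot all_order all_algebra.
From mathcomp Require Import all_classical all_reals all_analysis.
From mathcomp Require Import complex.

(** Local finiteness forces [G] to be discrete with finitely many units: the
compact open subsets of [c @^-1` [set h]] have linearly independent indicators
as soon as each contains a point that the others miss, so this open set is finite
([ample_open_finite]), and in a Hausdorff space its points are then open. All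
units lie over [1]. Second countability makes [G] countable, and the algebra is
spanned by the indicators of single arrows.

A simple module [M] is now shown to be finite-dimensional, which is more than
CCR. If [G] is finite this is clear, as [M] is generated by one vector. This
covers a countable field [K]: the dimension of the algebra being less than the
cardinality of [K], it is then finite, and so is [G]. Otherwise [K] is
uncountable. Fix a unit [u] with [u M <> 0] and an abelian subgroup [N] of finite
index in the isotropy group at [u]. The arrows with range [u] form finitely many
cosets [N y], so [M] is finitely generated over [N] modulo the kernel of [u], and
Zorn's lemma yields a maximal proper [N]-stable subspace [W] containing this
kernel ([exists_maximal_stable]). [M] has countable dimension over the
uncountable algebraically closed field [K], so by Amitsur's resolvent argument
each element of the commutative group [N] acts on the simple quotient [M / W] by
a scalar ([scalar_modulo]), and [W] has codimension one
([maximal_stable_codim1]). The vectors which all arrows with range [u] send into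
[W] form a proper submodule, hence only 0 is such a vector. Since [W] is
[N]-stable, membership in this submodule is decided by one representative of
each coset [N y], that is, by finitely many linear forms; their number bounds
the dimension of [M] ([simple_module_finite_dim]). *)

Set Implicit Arguments.
Unset Strict Implicit.
Unset Printing Implicit Defensive.

Import Order.TTheory GRing.Theory Num.Theory.
Local Open Scope classical_set_scope.
Local Open Scope ring_scope.

(** * Subspaces of bounded dimension *)

Section Subspaces.
Context {K : fieldType} {V : lmodType K}.
Implicit Types W : set V.

Definition linear_subspace W : Prop :=
  W 0 /\ forall (a : K) x y, W x -> W y -> W (a *: x + y).

Lemma subspaceD W x y : linear_subspace W -> W x -> W y -> W (x + y).
Proof. by move=> [_ hW] Wx Wy; rewrite -[x]scale1r; exact: hW. Qed.

Lemma subspaceZ W (a : K) x : linear_subspace W -> W x -> W (a *: x).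
Proof. by move=> [W0 hW] Wx; rewrite -[_ *: _]addr0; exact: hW. Qed.

Lemma subspaceB W x y : linear_subspace W -> W x -> W y -> W (x - y).
Proof.
by move=> hW Wx Wy; apply: subspaceD => //; rewrite -scaleN1r; exact: subspaceZ.
Qed.

Lemma subspace_sum W (I : finType) (F : I -> V) :
  linear_subspace W -> (forall i, W (F i)) -> W (\sum_i F i).
Proof.
move=> hW hF; elim/big_ind: _ => //; first exact: hW.1.
by move=> x y; exact: subspaceD.
Qed.

Lemma linear_span_subspace (B : set V) : linear_subspace (linear_span B).
Proof.
split; first by exists 0%N, (fun=> 0), (fun=> 0); split=> [[]//|]; rewrite big_ord0.
move=> a _ _ [n [b [e [eB ->]]]] [m [b' [e' [e'B ->]]]].
exists (n + m)%N,
  (fun i : 'I_(n + m) => match fintype.split i with inl j => a * b j | inr j => b' j end),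
  (fun i : 'I_(n + m) => match fintype.split i with inl j => e j | inr j => e' j end).
split=> [i|]; first by case: (fintype.split i).
rewrite big_split_ord /= scaler_sumr; congr (_ + _); apply: eq_bigr => i _.
  by rewrite (unsplitK (inl i)) scalerA.
by rewrite (unsplitK (inr i)).
Qed.

Lemma sub_linear_span (B : set V) : B `<=` linear_span B.
Proof.
move=> x Bx; exists 1%N, (fun=> 1), (fun=> x); split=> //.
by rewrite big_ord1 scale1r.
Qed.

Lemma linear_span_min (B W : set V) :
  linear_subspace W -> B `<=` W -> linear_span B `<=` W.
Proof.
move=> hW BW _ [n [a [e [eB ->]]]]; apply: subspace_sum => // i.
by apply: subspaceZ => //; apply: BW.
Qed.

Lemma linear_span_range n (e : 'I_n -> V) v :
  linear_span (range e) v -> exists a : 'I_n -> K, v = \sum_i a i *: e i.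
Proof.
set W := [set v | exists a : 'I_n -> K, v = \sum_i a i *: e i].
suff: linear_span (range e) `<=` W by apply.
apply: linear_span_min.
  split; first by exists (fun=> 0); rewrite big1 // => i _; rewrite scale0r.
  move=> a _ _ [b ->] [b' ->]; exists (fun i => a * b i + b' i).
  rewrite scaler_sumr -big_split; apply: eq_bigr => i _ /=.
  by rewrite scalerDl scalerA.
move=> _ [i _ <-]; exists (fun j => (j == i)%:R).
rewrite (bigD1 i) //= eqxx scale1r big1 ?addr0 // => j /negbTE ->.
by rewrite scale0r.
Qed.

Definition dependent n (f : 'I_n -> V) : Prop :=
  exists2 c : 'I_n -> K, (exists i, c i != 0) & \sum_i c i *: f i = 0.

(** Stated through dependence of large families, the bound needs no basis and
passes to arbitrary subsets. *)
Definition dim_at_most k W : Prop :=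
  forall f : 'I_k.+1 -> V, (forall i, W (f i)) -> dependent f.

(** A matrix with more rows than columns has a nontrivial left kernel. *)
Lemma wide_kernel k (A : 'M[K]_(k.+1, k)) :
  exists2 c : 'rV[K]_k.+1, (exists i, c 0 i != 0) & c *m A = 0.
Proof.
have : kermx A != 0.
  rewrite kermx_eq0 /row_free; apply/negP => /eqP rA.
  by have := rank_leq_col A; rewrite rA ltnn.
case/rowV0Pn => c /sub_kermxP cA c0; exists c => //.
by apply/rV0Pn.
Qed.

Lemma dim_at_most_span k (e : 'I_k -> V) :
  dim_at_most k (linear_span (range e)).
Proof.
move=> f fe; have [A fA] := choice (fun i => linear_span_range (fe i)).
have [c c0 cA] := wide_kernel (\matrix_(i, j) A i j).
exists (fun i => c 0 i) => //.
under eq_bigr => i _ do rewrite fA scaler_sumr.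
rewrite exchange_big big1 //= => j _.
transitivity ((c *m \matrix_(i, j) A i j) 0 j *: e j); last first.
  by rewrite cA mxE scale0r.
rewrite mxE scaler_suml; apply: eq_bigr => i _.
by rewrite mxE scalerA.
Qed.

Lemma dim_at_mostS k W W' : W' `<=` W -> dim_at_most k W -> dim_at_most k W'.
Proof. by move=> sW hW f fW; apply: hW => i; apply: sW. Qed.

(** The bound provides an independent family of maximal length, and such a family
spans. *)
Lemma dim_at_most_finite k W :
  linear_subspace W -> dim_at_most k W -> finite_dimensional W.
Proof.
move=> hW hk.
pose P n := `[< exists2 f : 'I_n -> V, (forall i, W (f i)) & ~ dependent f >].
have P0 : exists n, P n.
  exists 0%N; apply/asboolP; exists (fun=> 0) => [[]//|].
  by case=> c [[]].
have Pk n : P n -> (n <= k)%N.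
  move=> /asboolP[f fW nf]; rewrite leqNgt; apply/negP => kn; apply: nf.
  have [c [i ci0] cf] := hk (f \o widen_ord kn) (fun i => fW _).
  pose c' (j : 'I_n) := if insub (val j) is Some i then c i else 0.
  have c'E i' : c' (widen_ord kn i') = c i' by rewrite /c' /= valK.
  exists c'; first by exists (widen_ord kn i); rewrite c'E.
  rewrite (bigID (fun j : 'I_n => (j < k.+1)%N)) /= [X in _ + X]big1; last first.
    by move=> j /negbTE jk; rewrite /c' insubF // scale0r.
  rewrite addr0 (big_ord_narrow kn) -[RHS]cf.
  by apply: eq_bigr => j _; rewrite c'E.
case: (ex_maxnP P0 Pk) => n /asboolP[f fW nf] nmax.
exists (range f); first exact: finite_image (@finite_finset 'I_n setT).
split.
  move=> p a e einj eB ae i0.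
  have /choice[s sE] : forall i, exists j, f j = e i.
    by move=> i; have [j _ fj] := eB i; exists j.
  have sinj : injective s by move=> i j sij; apply: einj; rewrite -!sE sij.
  apply: contrapT => /eqP ai0; apply: nf.
  exists (fun j => \sum_(i | s i == j) a i).
    exists (s i0); rewrite (big_pred1 i0) // => i /=.
    by rewrite (inj_eq sinj).
  rewrite -[RHS]ae (partition_big s predT) //=; apply: eq_bigr => j _.
  by rewrite scaler_suml; apply: eq_bigr => i /eqP <-; rewrite sE.
apply/seteqP; split.
  by apply: linear_span_min => // _ [i _ <-].
move=> v Wv; have : ~~ P n.+1 by apply/negP => /nmax; rewrite ltnn.
pose g (i : 'I_n.+1) := if unlift ord0 i is Some j then f j else v.
have g0 : g ord0 = v by rewrite /g unlift_none.
have gS j : g (lift ord0 j) = f j by rewrite /g liftK.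
move=> /asboolPn nP; have : dependent g.
  apply: contrapT => ng; apply: nP; exists g => // i.
  by rewrite /g; case: (unlift _ _).
case=> c [i ci0]; rewrite big_ord_recl g0.
under eq_bigr => j _ do rewrite gS.
have sp := linear_span_subspace (range f).
have [c00|c00] := eqVneq (c ord0) 0.
  rewrite c00 scale0r add0r => cf; case: nf.
  exists (fun j => c (lift ord0 j)) => //.
  by case: (unliftP ord0 i) ci0 => [j ->|->]; [exists j | rewrite c00 eqxx].
move=> /eqP; rewrite addr_eq0 => /eqP cv.
rewrite -[v]scale1r -(mulVf c00) -scalerA cv.
apply: subspaceZ => //; rewrite -sumrN; apply: subspace_sum => // j.
by rewrite -scaleNr; apply: subspaceZ => //; apply: sub_linear_span; exists j.
Qed.

End Subspaces.

Lemma finite_enum T (A : set T) : finite_set A ->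
  exists n (f : 'I_n -> T), range f = A.
Proof.
move=> /finite_setP[n An].
have /card_esym/card_bijP[f [g fg gf]] := card_eq_trans An card_II.
exists n, (fun i => val (f (SigSub (mem_set (I : [set: 'I_n] i))))).
apply/seteqP; split=> [_ [i _ <-]|x Ax]; first exact: set_valP.
exists (val (g (SigSub (mem_set Ax)))) => //.
by rewrite (_ : SigSub _ = g (SigSub (mem_set Ax))) ?gf //; exact: val_inj.
Qed.

(** * Resolvents of an operator *)

Section Resolvent.
Context {K : closedFieldType} {V : lmodType K}.
Variable T : {linear V -> V}.

Definition poly_op (p : {poly K}) (v : V) : V :=
  \sum_(i < size p) p`_i *: iter i T v.

Lemma poly_op_widen n (p : {poly K}) v : (size p <= n)%N ->
  poly_op p v = \sum_(i < n) p`_i *: iter i T v.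
Proof.
move=> pn; rewrite /poly_op (big_ord_widen n (fun i => p`_i *: iter i T v)) //.
rewrite [RHS](bigID (fun i : 'I_n => (i < size p)%N)) /= [X in _ + X]big1 ?addr0 //.
by move=> i; rewrite -leqNgt => pi; rewrite nth_default // scale0r.
Qed.

Lemma poly_opD p q v : poly_op (p + q) v = poly_op p v + poly_op q v.
Proof.
rewrite (poly_op_widen _ (size_polyD p q)) (poly_op_widen _ (leq_maxl (size p) (size q))).
rewrite (poly_op_widen _ (leq_maxr (size p) (size q))) -big_split.
by apply: eq_bigr => i _; rewrite coefD scalerDl.
Qed.

Lemma poly_opZ (a : K) p v : poly_op (a *: p) v = a *: poly_op p v.
Proof.
rewrite (poly_op_widen _ (size_scale_leq a p)) /poly_op scaler_sumr.
by apply: eq_bigr => i _; rewrite coefZ scalerA.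
Qed.

Lemma poly_op0 v : poly_op 0 v = 0.
Proof. by rewrite /poly_op size_poly0 big_ord0. Qed.

Lemma poly_op1 v : poly_op 1 v = v.
Proof. by rewrite /poly_op size_poly1 big_ord1 coef1 scale1r. Qed.

Lemma poly_op_sum (I : finType) (c : I -> K) (F : I -> {poly K}) v :
  poly_op (\sum_i c i *: F i) v = \sum_i c i *: poly_op (F i) v.
Proof.
apply: (big_ind2 (fun p x => poly_op p v = x)); first exact: poly_op0.
  by move=> p x q y <- <-; exact: poly_opD.
by move=> i _; exact: poly_opZ.
Qed.

Lemma poly_op_linear p : linear (poly_op p).
Proof.
move=> a x y; rewrite /poly_op scaler_sumr -big_split; apply: eq_bigr => i _ /=.
suff -> : iter i T (a *: x + y) = a *: iter i T x + iter i T y.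
  by rewrite scalerDr !scalerA mulrC.
by elim: (i : nat) => //= n ->; rewrite linearP.
Qed.

HB.instance Definition _ p :=
  GRing.isLinear.Build K V V *:%R (poly_op p) (poly_op_linear p).

Lemma poly_op_stable (W : set V) p v : linear_subspace W ->
  (forall x, W x -> W (T x)) -> W v -> W (poly_op p v).
Proof.
move=> hW TW Wv; apply: subspace_sum => // i; apply: subspaceZ => //.
by elim: (i : nat) => //= n; apply: TW.
Qed.

Lemma poly_opX p v : poly_op ('X * p) v = T (poly_op p v).
Proof.
rewrite (@poly_op_widen (size p).+1); last first.
  by have [->|p0] := eqVneq p 0; rewrite ?mulr0 ?size_poly0 // mulrC size_mulX.
rewrite big_ord_recl coefXM scale0r add0r /poly_op linear_sum.
by apply: eq_bigr => i _; rewrite linearZ coefXM.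
Qed.

Lemma poly_op_comm p v : poly_op p (T v) = T (poly_op p v).
Proof.
by rewrite linear_sum; apply: eq_bigr => i _; rewrite linearZ -iterSr.
Qed.

Lemma poly_op_XsubC (b : K) p v :
  poly_op (('X - b%:P) * p) v = T (poly_op p v) - b *: poly_op p v.
Proof.
by rewrite mulrBl poly_opD poly_opX mul_polyC -scaleNr poly_opZ scaleNr.
Qed.

(** The partial fraction argument: over a common denominator, a relation between
the [(T - a i)^-1 w] becomes [q(T) w = 0], where the numerator [q] is nonzero and
splits into factors [T - b], all injective. *)
Lemma resolvents_independent (W : set V) (u : K -> V) (w : V) n (a : 'I_n -> K) :
  linear_subspace W -> (forall v, W v -> W (T v)) ->
  (forall b v, W (T v - b *: v) -> W v) -> ~ W w ->
  (forall b, W (T (u b) - b *: u b - w)) ->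
  injective a -> ~ dependent (u \o a).
Proof.
move=> hW TW inj Ww uW ainj [c [i0 ci0] cu].
pose P i := \prod_(j < n | j != i) ('X - (a j)%:P).
pose q := \sum_i c i *: P i.
have q0 : q != 0.
  apply/eqP => /(congr1 (horner^~ (a i0))); rewrite horner0 horner_sum.
  rewrite (bigD1 i0) //= big1 => [|i ii0]; last first.
    rewrite hornerZ /P (bigD1 i0) 1?eq_sym //= hornerM.
    by rewrite hornerXsubC subrr mul0r mulr0.
  rewrite addr0 hornerZ horner_prod => /eqP.
  rewrite mulf_eq0 (negbTE ci0) /= prodf_seq_eq0 => /hasP[j _ /andP[ji]].
  by rewrite hornerXsubC subr_eq0 => /eqP/ainj ij; rewrite ij eqxx in ji.
have qw : W (poly_op q w).
  pose A := \prod_(j < n) ('X - (a j)%:P).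
  have Au i : W (poly_op A (u (a i)) - poly_op (P i) w).
    rewrite /A (bigD1 i) //= poly_op_XsubC -/(P i) -poly_op_comm.
    by rewrite -linearZ -!linearB; exact: poly_op_stable.
  have -> : poly_op q w = \sum_i c i *: (poly_op (P i) w - poly_op A (u (a i))).
    under [RHS]eq_bigr => i _ do rewrite scalerBr -[in X in _ - X]linearZ.
    by rewrite sumrB -linear_sum cu linear0 subr0 poly_op_sum.
  apply: subspace_sum => // i; apply: subspaceZ => //.
  by rewrite -opprB -sub0r; apply: subspaceB => //; exact: hW.1.
have [r qE] := closed_field_poly_normal q.
have : W (poly_op (\prod_(z <- r) ('X - z%:P)) w).
  have -> : \prod_(z <- r) ('X - z%:P) = (lead_coef q)^-1 *: q.
    by rewrite {2}qE scalerA mulVf ?scale1r // lead_coef_eq0.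
  by rewrite poly_opZ; exact: subspaceZ.
move=> Wr; apply: Ww; elim: r {qE} Wr => [|z r ih]; first by rewrite big_nil poly_op1.
by rewrite big_cons poly_op_XsubC => /inj.
Qed.

End Resolvent.

(** * Maximal stable subspaces *)

Lemma infinite_injection T (A : set T) n : infinite_set A ->
  exists2 f : 'I_n -> T, injective f & forall i, A (f i).
Proof.
move=> /infiniteP/card_leP[f].
exists (fun i => val (f (SigSub (mem_set (I : [set: nat] i))))); last first.
  by move=> i; exact: set_valP.
move=> i j /val_inj /inj; rewrite !inE => /(_ I I) /(congr1 val) /= ij.
exact: val_inj.
Qed.

(** Each [u i] lies in the span of the first [n] vectors for some [n]. As there
are uncountably many indices, one and the same [n] serves infinitely many of
them, and more than [n] vectors in that span are dependent. *)
Lemma uncountable_dependent (K : fieldType) (V : lmodType K) (T I : Type)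
    (e : T -> V) (u : I -> V) :
  countable [set: T] -> linear_span (range e) = setT -> ~ countable [set: I] ->
  exists n (a : 'I_n -> I), injective a /\ dependent (u \o a).
Proof.
move=> /countable_injP[code cinj] eV nI; apply: contrapT => nex.
pose E n := [set g : T | (code g < n)%N].
pose S n := [set i | linear_span (e @` E n) (u i)].
apply: nI; have -> : [set: I] = \bigcup_n S n.
  apply/seteqP; split => // i _.
  have : linear_span (range e) (u i) by rewrite eV.
  case=> m [a [f [fe uE]]].
  have [g gE] : exists g : 'I_m -> T, forall j, e (g j) = f j.
    suff /choice[g gE] : forall j, exists x, e x = f j by exists g.
    by move=> j; have [x _ <-] := fe j; exists x.
  exists (\max_j code (g j)).+1 => //; exists m, a, f; split=> // j.
  by exists (g j) => //; rewrite /E /= ltnS (leq_bigmax j).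
apply: bigcup_countable => // n _; apply: finite_set_countable.
have fE : finite_set (E n).
  have := finite_preimage (B := `I_n) (f := code).
  by apply=> //; move=> x y _ _; apply: cinj; rewrite inE.
apply: contrapT => Sn; apply: nex.
have [k [f fE']] := finite_enum (finite_image e fE).
have [a ainj aS] := infinite_injection k.+1 Sn.
exists k.+1, a; split => //; apply: (@dim_at_most_span _ _ _ f) => i.
by rewrite fE'; exact: aS.
Qed.

Section StableSubspaces.
Context {K : fieldType} {V : lmodType K} {I : Type}.
Variables (N : set I) (T : I -> {linear V -> V}).

Definition stable_subspace (W : set V) : Prop :=
  linear_subspace W /\ forall i, N i -> forall v, W v -> W (T i v).

Definition maximal_stable (W : set V) : Prop :=
  [/\ stable_subspace W, W <> setT &
      forall W', stable_subspace W' -> W `<=` W' -> W' `<=` W \/ W' = setT].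

(** Zorn's lemma applies because the whole space is finitely generated over [W0]:
a stable subspace containing [W0] is improper only if it contains a given finite
family, so the union of a chain of proper ones is proper. *)
Lemma exists_maximal_stable (W0 : set V) k (g : 'I_k -> V) :
  stable_subspace W0 -> W0 <> setT ->
  (forall W, stable_subspace W -> W0 `<=` W -> (forall i, W (g i)) -> W = setT) ->
  exists2 W, W0 `<=` W & maximal_stable W.
Proof.
move=> sW0 pW0 gen.
(* The empty set is admitted as the union of the empty chain. *)
pose P W := W = set0 \/ [/\ stable_subspace W, W0 `<=` W & W <> setT].
have W00 : W0 0 by case: sW0 => -[].
have [F FP Ftot|W [[W_0|[sW W0W pW]] Wmax]] := @Zorn_bigcup V P.
- have [allempty|/existsNP[X0 /not_implyP[FX0 X0ne]]] :=
    pselect (forall X, F X -> X = set0).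
    left; apply/seteqP; split => // x [X FX]; by rewrite (allempty _ FX).
  have good X x : F X -> X x ->
      [/\ stable_subspace X, W0 `<=` X & X <> setT].
    by move=> FX Xx; case: (FP X FX) => // X_0; rewrite X_0 in Xx.
  have [x0 X0x0] : X0 !=set0 by apply/set0P/eqP.
  have [[[X00 _] _] W0X0 _] := good _ _ FX0 X0x0.
  have up X Y x y : F X -> F Y -> X x -> Y y -> exists2 Z, F Z & Z x /\ Z y.
    move=> FX FY Xx Yy; case: (Ftot X Y FX FY) => sub.
      by exists Y => //; split=> //; exact: sub.
    by exists X => //; split=> //; exact: sub.
  right; split.
  + split; first split; first by exists X0.
      move=> a x y [X FX Xx] [Y FY Yy]; have [Z FZ [Zx Zy]] := up _ _ _ _ FX FY Xx Yy.
      have [[[_ hZ] _] _ _] := good _ _ FZ Zx.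
      by exists Z => //; exact: hZ.
    move=> i Ni v [X FX Xv]; exists X => //.
    by have [[_ hX] _ _] := good _ _ FX Xv; exact: hX.
  + by move=> x /W0X0; exists X0.
  + move=> UT; have gU i : exists X, F X /\ X (g i).
      have : (\bigcup_(X in F) X) (g i) by rewrite UT.
      by case=> X; exists X.
    have [X XF] := choice gU.
    have [Z FZ Zg] : exists2 Z, F Z & forall i, i \in enum 'I_k -> Z (g i).
      elim: (enum 'I_k) => [|i s [Z FZ Zs]]; first by exists X0.
      have [FX Xg] := XF i; case: (Ftot _ _ FZ FX) => sub.
        exists (X i) => // j; rewrite inE => /orP[/eqP-> //|/Zs]; exact: sub.
      exists Z => // j; rewrite inE => /orP[/eqP-> |/Zs //]; exact: sub.
    have [z Zz] : Z !=set0.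
      apply/set0P/eqP => Z0.
      have [i _] : exists i : 'I_k, True.
        apply: contrapT => nk; apply: pW0; apply: gen => // i.
        by case: nk; exists i.
      by have := Zg i; rewrite mem_enum Z0 => /(_ isT).
    have [sZ W0Z pZ] := good _ _ FZ Zz; apply: pZ; apply: gen => // i.
    by apply: Zg; rewrite mem_enum.
- exfalso; apply: (Wmax W0); last by right; split.
  by rewrite W_0; split => [x//|sub]; exact: (sub _ W00).
- exists W => //; split => // W' sW' WW'.
  have [->|pW'] := pselect (W' = setT); [by right|left].
  apply: contrapT => nsub; apply: (Wmax W'); first by split.
  by right; split => //; exact: subset_trans WW'.
Qed.

End StableSubspaces.

Section CommutingOperators.
Context {K : closedFieldType} {V : lmodType K} {I X : Type}.
Variables (N : set I) (T : I -> {linear V -> V}) (e : X -> V).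
Hypothesis commT : forall i j, N i -> N j -> forall v, T i (T j v) = T j (T i v).
Hypotheses (countX : countable [set: X]) (spanX : linear_span (range e) = setT).
Hypothesis uncountK : ~ countable [set: K].
Variable W : set V.
Hypothesis maxW : maximal_stable N T W.

(** Schur's lemma for the simple quotient [V / W]: otherwise all [T i - a] would be
invertible on it, and their inverses at one vector would form an uncountable
independent family. *)
Lemma scalar_modulo i : N i -> exists a : K, forall v, W (T i v - a *: v).
Proof.
move=> Ni; have [[hW TW] pW max] := maxW.
apply: contrapT => /forallNP nscal.
have D a := nscal a.
have Dlin a b x y : T i (b *: x + y) - a *: (b *: x + y) =
    b *: (T i x - a *: x) + (T i y - a *: y).
  rewrite linearP scalerDr opprD addrACA scalerBr !scalerA.
  by rewrite [in RHS]mulrC.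
have Dcomm a j v : N j -> T i (T j v) - a *: T j v = T j (T i v - a *: v).
  by move=> Nj; rewrite (linearB (T j)) (linearZ_LR (T j)) (commT Ni Nj).
have inj a v : W (T i v - a *: v) -> W v.
  (* The preimage of [W] under [T i - a] is stable, hence equal to [W]. *)
  pose W' := [set v | W (T i v - a *: v)].
  have sW' : stable_subspace N T W'.
    split; first split; rewrite /W' /=.
    - by rewrite linear0 scaler0 subr0; exact: hW.1.
    - by move=> b x y Wx Wy; rewrite Dlin; exact: hW.2.
    - by move=> j Nj x Wx; rewrite Dcomm //; exact: TW.
  have WW' : W `<=` W'.
    by move=> x Wx; apply: subspaceB => //; [exact: TW|exact: subspaceZ].
  case: (max W' sW' WW') => [sub|W'T]; first exact: sub.
  by case: (D a) => x; have : W' x by rewrite W'T.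
have [w Ww] : exists w, ~ W w.
  by apply: contrapT => /forallNP nW; apply: pW; apply/seteqP; split => // x _;
     apply: contrapT; exact: nW.
have sur a : exists u, W (T i u - a *: u - w).
  (* The image of [T i - a] plus [W] is stable and larger than [W]. *)
  pose W' := [set v | exists2 u, True & W (T i u - a *: u - v)].
  have sW' : stable_subspace N T W'.
    split; first split.
    - by exists 0 => //; rewrite linear0 scaler0 !subr0; exact: hW.1.
    - move=> b x y [u _ Wu] [v _ Wv]; exists (b *: u + v) => //.
      by rewrite Dlin opprD addrACA -scalerBr; exact: hW.2.
    - move=> j Nj x [u _ Wu]; exists (T j u) => //.
      by rewrite Dcomm // -(linearB (T j)); exact: TW.
  have WW' : W `<=` W'.
    move=> x Wx; exists 0 => //; rewrite linear0 scaler0 subrr.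
    by apply: subspaceB => //; exact: hW.1.
  case: (max W' sW' WW') => [sub|W'T]; last first.
    by have [u _ ?] : W' w; [rewrite W'T|exists u].
  case: (D a) => v; apply: sub; exists v => //.
  by rewrite subrr; exact: hW.1.
have [u uW] := choice sur.
have [n [a [ainj adep]]] := uncountable_dependent u countX spanX uncountK.
exact: (resolvents_independent (T := T i) hW (TW i Ni) inj Ww uW ainj adep).
Qed.

(** Since every [T i] is a scalar modulo [W], adding any line to [W] keeps it
stable, and by maximality the result is everything. *)
Lemma maximal_stable_codim1 : exists w, forall v, exists a : K, W (v - a *: w).
Proof.
have [[hW TW] pW max] := maxW.
have [w Ww] : exists w, ~ W w.
  by apply: contrapT => /forallNP nW; apply: pW; apply/seteqP; split => // x _;
     apply: contrapT; exact: nW.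
exists w; pose W' := [set v | exists a : K, W (v - a *: w)].
have sW' : stable_subspace N T W'.
  split; first split.
  - by exists 0; rewrite scale0r subr0; exact: hW.1.
  - move=> b x y [a Wa] [a' Wa']; exists (b * a + a').
    rewrite scalerDl opprD addrACA -scalerA -scalerBr.
    exact: hW.2.
  - move=> i Ni v [a Wa]; have [b Wb] := scalar_modulo Ni; exists (b * a).
    have -> : T i v - (b * a) *: w =
        T i (v - a *: w) + a *: (T i w - b *: w).
      by rewrite (linearB (T i)) (linearZ_LR (T i)) scalerBr scalerA [a * b]mulrC addrA subrK.
    by apply: subspaceD => //; [exact: TW|exact: subspaceZ].
have WW' : W `<=` W' by move=> x Wx; exists 0; rewrite scale0r subr0.
case: (max W' sW' WW') => [sub|W'T v]; last by have : W' v by rewrite W'T.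
by case: Ww; apply: sub; exists 1; rewrite scale1r subrr; exact: hW.1.
Qed.

End CommutingOperators.

(** * Simple modules over a discrete groupoid *)

(** The arrows [g] with range [u] are classified up to left multiplication by [N]
by the sets [g^-1 N]. If [h] is one such arrow with source [v], then the others
with this source have [g^-1 N = h^-1 (h g^-1 N)], the translate of a coset in the
isotropy group; so there are finitely many such sets for each of the finitely
many units [v]. *)
Lemma finite_coset_representatives (G : groupoidType) (u : G) (N : set G) :
  isotropy_subgroup u N -> finite_set [set gmul x @` N | x in isotropy u] ->
  finite_set (units G) ->
  exists k (y : 'I_k -> G), (forall i, grng (y i) = u) /\
    forall g, grng g = u -> exists i n, N n /\ g = gmul n (y i).
Proof.
move=> [Niso Nu Nmul Ninv] fcos fun_.
pose C := [set g : G | grng g = u].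
pose D (g : G) : set G := gmul (ginv g) @` N.
have fD : finite_set (D @` C).
  apply: (@sub_finite_set _ _
    (\bigcup_(v in units G) (D @` [set g | C g /\ gsrc g = v]))).
    move=> _ [g Cg <-]; exists (gsrc g); last by exists g.
    exact: grng_src.
  apply: bigcup_finite => // v _.
  have [[h [Ch hv]]|nh] := pselect (exists h, C h /\ gsrc h = v); last first.
    rewrite (_ : _ @` _ = set0) //; apply/seteqP; split => // S [g Cg _].
    by apply: nh; exists g.
  apply: sub_finite_set (finite_image (fun S => gmul (ginv h) @` S) fcos).
  move=> _ [g [Cg gv] <-].
  have hg : gsrc h = grng (ginv g) by rewrite grng_inv gv.
  exists (gmul (gmul h (ginv g)) @` N).
    exists (gmul h (ginv g)) => //; split; first by rewrite grng_mul.
    by rewrite gsrc_mul // gsrc_inv.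
  rewrite image_comp; apply: eq_imagel => n Nn /=.
  have gn : gsrc (ginv g) = grng n by rewrite gsrc_inv Cg; case: (Niso _ Nn) => ->.
  rewrite -(gmulA _ _ _ hg gn) gmulA ?gsrc_inv ?(grng_mul _ _ gn) //.
  by rewrite gmulVx hg -(grng_mul _ _ gn) gmul_rng.
have [k [d dE]] := finite_enum fD.
have /choice[y yE] : forall i, exists y, C y /\ D y = d i.
  move=> i; have : (D @` C) (d i) by rewrite -dE; exists i.
  by case=> y Cy yd; exists y.
exists k, y; split=> [i|g Cg]; first by have [] := yE i.
have : (D @` C) (D g) by exists g.
rewrite -dE => -[i _ di]; have [Cy yd] := yE i; exists i.
have : D g (ginv g).
  by exists u => //; rewrite -[RHS]gmul_src gsrc_inv Cg.
rewrite -di -yd => -[n Nn ng]; exists (ginv n); split; first exact: Ninv.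
have [nr ns] := Niso _ Nn.
have yn : gsrc (ginv (y i)) = grng n by rewrite gsrc_inv Cy nr.
have sy : gsrc (y i) = gsrc g by rewrite -grng_inv -(grng_mul _ _ yn) ng grng_inv.
have yE' : y i = gmul n g.
  have -> : n = gmul (y i) (ginv g).
    by rewrite -ng gmulA ?grng_inv // gmulV Cy -nr gmul_rng.
  rewrite -gmulA ?grng_inv ?gsrc_inv //.
  by rewrite gmulVx -sy gmul_src.
by rewrite yE' gmulA ?gsrc_inv ?ns // gmulVx ns -Cg gmul_rng.
Qed.

Section GroupoidModules.
Context {G : groupoidType} {K : closedFieldType} {M : lmodType K}.
Variable T : G -> {linear M -> M}.
Hypothesis T_mul : forall x y m, gsrc x = grng y -> T (gmul x y) m = T x (T y m).
Hypothesis T_mul0 : forall x y m, gsrc x <> grng y -> T x (T y m) = 0.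
Hypothesis T_simple : forall W : set M, linear_subspace W ->
  (forall x m, W m -> W (T x m)) -> W `<=` [set 0] \/ W = setT.
Variables (x0 : G) (m0 : M).
Let u := grng x0.
Let m1 := T x0 m0.
Hypothesis m1_neq0 : m1 <> 0.

Let Tum1 : T u m1 = m1.
Proof. by rewrite /m1 -T_mul ?gmul_rng // gsrc_rng. Qed.

(** The span of the orbit of [m1] is a submodule, and it contains [m1 = u m1]. *)
Lemma orbit_spans : linear_span (range (fun g => T g m1)) = setT.
Proof.
set S := linear_span _; have hS : linear_subspace S := linear_span_subspace _.
have [x m Sm|S0|//] := T_simple hS.
  suff: S `<=` [set v | S (T x v)] by apply.
  apply: linear_span_min => [|_ [g _ <-] /=].
    split; first by rewrite /= linear0; exact: hS.1.
    by move=> a v v' Sv Sv' /=; rewrite linearP; exact: hS.2.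
  have [xg|xg] := pselect (gsrc x = grng g); last by rewrite T_mul0 //; exact: hS.1.
  by rewrite -T_mul //; apply: sub_linear_span; exists (gmul x g).
case: m1_neq0; apply: S0; apply: sub_linear_span; exists u => //.
Qed.

Lemma simple_module_finite_groupoid :
  finite_set [set: G] -> exists k, dim_at_most k [set: M].
Proof.
move=> /(finite_image (fun g => T g m1))/finite_enum[k [f fE]].
by exists k; rewrite -orbit_spans -fE; exact: dim_at_most_span.
Qed.

(** The heart of the matter: [M] embeds in a finite sum of copies of the line
[M / W], where [W] is a maximal [N]-stable subspace. *)
Lemma simple_module_finite_dim :
  finite_set (units G) -> countable [set: G] -> ~ countable [set: K] ->
  virtually_abelian_isotropy u -> exists k, dim_at_most k [set: M].
Proof.
move=> fU cG ncK [N [subN Ncomm fcos]].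
have [Niso Nu _ _] := subN.
have [k [y [yr yC]]] := finite_coset_representatives subN fcos fU.
have uu : gsrc u = u by rewrite gsrc_rng.
have ru : grng u = u by rewrite grng_rng.
(* Over the kernel of [T u] only arrows with range [u] matter for generation. *)
pose W0 := [set m | T u m = 0].
have W0sub m : W0 (m - T u m).
  rewrite /W0 /= linearB -T_mul ?uu ?ru //.
  by rewrite -{2}ru gmul_rng subrr.
have sW0 : stable_subspace N T W0.
  split; first split; rewrite /W0 /= ?linear0 //.
    by move=> a v v' hv hv'; rewrite linearP hv hv' scaler0 addr0.
  move=> n /Niso[nr ns] v Wv.
  rewrite -T_mul ?nr // (_ : gmul u n = gmul n u); last first.
    by rewrite -{1}nr gmul_rng -ns gmul_src.
  by rewrite T_mul ?ns ?ru // Wv linear0.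
have pW0 : W0 <> setT.
  by move=> W0T; apply: m1_neq0; rewrite -Tum1; have : W0 m1 by rewrite W0T.
have gen W : stable_subspace N T W -> W0 `<=` W ->
    (forall i, W (T (y i) m1)) -> W = setT.
  move=> [hW TW] W0W Wy; apply/seteqP; split => // m _.
  have : linear_span (range (fun g => T g m1)) m by rewrite orbit_spans.
  apply: linear_span_min => // _ [g _ <-].
  have [gu|gu] := pselect (grng g = u); last first.
    by apply: W0W; rewrite /W0 /= T_mul0 // uu => /esym.
  have [i [n [Nn ->]]] := yC g gu; rewrite T_mul; last first.
    by have [_ ->] := Niso _ Nn; rewrite yr.
  exact: TW.
have [W W0W maxW] := exists_maximal_stable sW0 pW0 gen.
have [[hW TW] pW _] := maxW.
have commT i j : N i -> N j -> forall v, T i (T j v) = T j (T i v).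
  move=> Ni Nj v; have [ir is_] := Niso _ Ni; have [jr js] := Niso _ Nj.
  by rewrite -!T_mul ?is_ ?jr ?js ?ir // Ncomm.
have [w wW] := maximal_stable_codim1 commT cG orbit_spans ncK maxW.
(* The largest submodule contained in [W]. *)
pose Z := [set m | forall g, grng g = u -> W (T g m)].
have hZ : linear_subspace Z.
  split=> [g _|a v v' Zv Zv' g gu]; first by rewrite linear0; exact: hW.1.
  by rewrite linearP; apply: hW.2; [exact: Zv|exact: Zv'].
have TZ x m : Z m -> Z (T x m).
  move=> Zm g gu; have [gx|gx] := pselect (gsrc g = grng x).
    by rewrite -T_mul //; apply: Zm; rewrite grng_mul.
  by rewrite T_mul0 //; exact: hW.1.
have Z0 : Z `<=` [set 0].
  case: (T_simple hZ TZ) => // ZT; case: pW; apply/seteqP; split => // m _.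
  rewrite -[m](subrK (T u m)); apply: subspaceD => //; first exact: W0W.
  by have : Z m by [rewrite ZT]; apply.
(* A combination of [k.+1] vectors whose [k] coordinates in [M / W] all vanish. *)
exists k => f _.
have /choice[A AE] : forall l, exists a : 'I_k -> K,
    forall i, W (T (y i) (f l) - a i *: w).
  by move=> l; have [a aW] := choice (fun i => wW (T (y i) (f l))); exists a.
have [c c0 cA] := wide_kernel (\matrix_(l, i) A l i).
exists (fun l => c 0 l) => //; apply: Z0 => g /yC[i [n [Nn ->]]].
rewrite T_mul; last by have [_ ->] := Niso _ Nn; rewrite yr.
apply: TW => //.
have -> : T (y i) (\sum_l c 0 l *: f l) =
    \sum_l c 0 l *: (T (y i) (f l) - A l i *: w).
  rewrite linear_sum; under [RHS]eq_bigr => l _ do rewrite scalerBr scalerA.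
  rewrite sumrB -scaler_suml.
  have -> : \sum_l c 0 l * A l i = (c *m \matrix_(l, i) A l i) 0 i.
    by rewrite mxE; apply: eq_bigr => l _; rewrite mxE.
  rewrite cA mxE scale0r subr0; apply: eq_bigr => l _; exact: linearZ_LR.
by apply: subspace_sum => // l; exact: subspaceZ.
Qed.

End GroupoidModules.

(** * Steinberg algebras of ample groupoids *)

Lemma hausdorff_finite_closed (T : topologicalType) (A : set T) :
  hausdorff_space T -> finite_set A -> closed A.
Proof.
by move=> /hausdorff_accessible/accessible_finite_set_closed; apply.
Qed.

Lemma finite_dimensional_dim_at_most (K : fieldType) (V : lmodType K) (W : set V) :
  finite_dimensional W -> exists k, dim_at_most k W.
Proof.
move=> [B /finite_enum[k [f <-]] [_ <-]]; exists k; exact: dim_at_most_span.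
Qed.

Section DiscreteGroupoids.
Context {G : groupoidTopType}.

(** Given finitely many points of [X], each has a compact open bisection in [X] as
a neighbourhood that misses the others; evaluation at the points shows that the
indicators of these are independent. *)
Lemma ample_open_finite (K : fieldType) k (W : set (G -> K^o)) (X : set G) :
  hausdorff_space G -> basis (@compact_open_bisection G) -> open X ->
  dim_at_most k W ->
  (forall U, compact_open_bisection U -> U `<=` X -> W \1_U) -> finite_set X.
Proof.
move=> hG [_ bG] oX dW WX; apply: contrapT => iX.
have [x xinj Xx] := infinite_injection k.+1 iX.
have /choice[U UE] : forall i, exists U, [/\ compact_open_bisection U, U `<=` X,
    U (x i) & forall j, j != i -> ~ U (x j)].
  move=> i; pose F := x @` [set j | j != i].
  have cF : closed F.
    apply: hausdorff_finite_closed => //.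
    exact: finite_image (@finite_finset _ _).
  have nX : nbhs (x i) (X `&` ~` F).
    apply: open_nbhs_nbhs; split; first by apply: openI => //; exact: closed_openC.
    by split=> // -[j ji /xinj ij]; rewrite /= ij eqxx in ji.
  have [U [cU Ux] UX] := bG (x i) _ nX.
  exists U; split=> // [y /UX[]//|j ji /UX[_]]; apply.
  by exists j.
have [c [j cj] cU] : dependent (fun i => \1_(U i) : G -> K^o).
  by apply: dW => i; have [cU UX _ _] := UE i; exact: WX.
move/eqP: cj; apply; have {cU} := congr1 (fun f => f (x j)) cU.
rewrite fct_sumE (bigD1 j) //= big1 => [|i ij].
  rewrite addr0 => cUj; have [_ _ Uj _] := UE j.
  rewrite -[RHS]/((0 : G -> K^o) (x j)) -cUj.
  rewrite -[RHS]/(c j * \1_(U j) (x j)).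
  by rewrite indicE mem_set // mulr1.
have [_ _ _ Ui] := UE i.
rewrite -[LHS]/(c i * \1_(U i) (x j)).
by rewrite indicE memNset ?mulr0 //; apply: Ui; rewrite eq_sym.
Qed.

Hypothesis discG : forall x : G, open [set x].

Lemma discrete_compact_finite (U : set G) : compact U -> finite_set U.
Proof.
move=> cU; apply: contrapT => iU.
(* A cluster point of the cofinite filter on [U] would not be isolated. *)
pose F : set_system G := fun A => finite_set (U `\` A).
have FF : ProperFilter F.
  split; first by rewrite /F setD0.
  split; rewrite /F; first by rewrite setDT; exact: finite_set0.
    by move=> A B; rewrite setDIr finite_setU.
  by move=> A B AB; apply: sub_finite_set; exact: setDS.
have [|x [_ clx]] := cU F FF; first by rewrite /F setDv; exact: finite_set0.
have [||y [/= yx]] := clx (~` [set x]) [set x].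
- by rewrite /F setDE setCK; exact: sub_finite_set (finite_set1 x).
- exact: open_nbhs_nbhs.
- exact: yx.
Qed.

Lemma compact_open_bisection1 (x : G) : compact_open_bisection [set x].
Proof.
split; [exact: compact_set1|exact: discG|].
by split; split=> [y yx|y z|//]; rewrite ?inE; [exists y|move=> -> ->|exists y|move=> -> ->].
Qed.

(** A compact set being finite, its indicator is a sum of indicators of points. *)
Lemma discrete_steinberg_min (K : fieldType) (W : set (G -> K^o)) :
  linear_subspace W -> (forall x, W \1_[set x]) -> steinberg_algebra K G `<=` W.
Proof.
move=> hW W1; apply: linear_span_min => // _ [U [cU _ _] <-].
have /finite_seqP[s ->] := discrete_compact_finite cU.
elim: s => [|x s ih].
  rewrite (_ : \1__ = 0); first exact: hW.1.
  by apply/funext => y; rewrite indicE memNset.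
have [xs|xs] := boolP (x \in s).
  rewrite (_ : [set` x :: s] = [set` s]) //.
  by apply/seteqP; split => y /=; rewrite inE; [case/orP=> [/eqP->|]|move=> ->; rewrite orbT].
rewrite (_ : \1__ = \1_[set x] + \1_[set` s]); first exact: subspaceD.
apply/funext => y; rewrite -[RHS]/(\1_[set x] y + \1_[set` s] y) !indicE.
have memE (t : seq G) : (y \in [set` t]) = (y \in t).
  by apply/idP/idP; rewrite in_setE.
have -> : (y \in [set x]) = (y == x).
  by apply/idP/idP => [|/eqP ->]; rewrite in_setE //= => ->.
rewrite !memE inE; have [->|_] := eqVneq y x; last by rewrite add0r.
by rewrite (negbTE xs) addr0.
Qed.

End DiscreteGroupoids.

(** The indicators of single arrows turn an irreducible representation into a
simple module over the groupoid [G], which is finite-dimensional in either case. *)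
Lemma discrete_CCR (K : closedFieldType) (G : groupoidTopType) :
  (forall x : G, open [set x]) -> finite_set (units G) ->
  finite_set [set: G] \/ (countable [set: G] /\ ~ countable [set: K]) ->
  (forall u : G, units G u -> virtually_abelian_isotropy u) -> CCR K G.
Proof.
move=> discG fU card VA M rho [[lin bil mul] [f0 [m0 [Af0 nz]]] irr].
have hA : linear_subspace (steinberg_algebra K G) := linear_span_subspace _.
have A1 x : steinberg_algebra K G \1_[set x].
  by apply: sub_linear_span; exists [set x] => //; exact: compact_open_bisection1.
have rho0 m : rho 0 m = 0.
  have := bil 1 0 0 m hA.1 hA.1; rewrite !scale1r addr0.
  by move/(congr1 (fun z => z - rho 0 m)); rewrite subrr addrK => <-.
pose T x : {linear M -> M} := HB.pack (rho \1_[set x])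
  (GRing.isLinear.Build K M M *:%R (rho \1_[set x]) (lin _ (A1 x))).
have Tconv x y m : T x (T y m) = rho \1_(gmul_set [set x] [set y]) m.
  rewrite /= -mul // convolution_indic //.
  by have [] := compact_open_bisection1 discG x.
have T_mul x y m : gsrc x = grng y -> T (gmul x y) m = T x (T y m).
  move=> xy; rewrite Tconv /=; congr (rho \1__ m); apply/seteqP; split.
    by move=> _ ->; exists x, y.
  by move=> _ [_ [_ [-> -> _ ->]]].
have T_mul0 x y m : gsrc x <> grng y -> T x (T y m) = 0.
  move=> xy; rewrite Tconv (_ : gmul_set _ _ = set0) ?indic0 ?rho0 //.
  by apply/seteqP; split => // z [_ [_ [-> -> /xy]]].
have inv_rho (W : set M) f m : linear_subspace W -> (forall x m, W m -> W (T x m)) ->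
    steinberg_algebra K G f -> W m -> W (rho f m).
  move=> hW TW Af Wm.
  pose S := [set g | steinberg_algebra K G g /\ W (rho g m)].
  suff /(_ f Af)[] : steinberg_algebra K G `<=` S by [].
  apply: discrete_steinberg_min => // [|x].
    split; first by split; [exact: hA.1|rewrite rho0; exact: hW.1].
    move=> a g h [Ag Wg] [Ah Wh]; split; first exact: hA.2.
    by rewrite bil //; exact: hW.2.
  by split => //; exact: TW.
have T_simple (W : set M) : linear_subspace W ->
    (forall x m, W m -> W (T x m)) -> W `<=` [set 0] \/ W = setT.
  move=> hW TW; pose P : {pred M} := fun m => `[<W m>].
  have PE m : (m \in P) = `[<W m>] by [].
  have cP : submod_closed P.
    split; first by rewrite PE; apply/asboolP; exact: hW.1.
    move=> a x y; rewrite !PE => /asboolP Wx /asboolP Wy; apply/asboolP; exact: hW.2.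
  have iP f : steinberg_algebra K G f -> {in P, forall m, rho f m \in P}.
    by move=> Af m; rewrite !PE => /asboolP Wm; apply/asboolP; exact: inv_rho.
  have [P0|PT] := irr P cP iP; [left|right].
    by move=> m /asboolP Wm; have := P0 m; rewrite PE Wm => /esym /eqP.
  apply/seteqP; split => // m _; apply/asboolP.
  by rewrite -PE PT.
have [x1 Tx1] : exists x, T x m0 <> 0.
  apply: contrapT => /forallNP nT; apply: nz.
  pose S := [set g | steinberg_algebra K G g /\ rho g m0 = 0].
  suff /(_ f0 Af0)[] : steinberg_algebra K G `<=` S by [].
  apply: discrete_steinberg_min => // [|x].
    split; first by split; [exact: hA.1|exact: rho0].
    move=> a g h [Ag Wg] [Ah Wh]; split; first exact: hA.2.
    by rewrite bil // Wg Wh scaler0 addr0.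
  by split => //; exact: contrapT (nT x).
have [k Mk] : exists k, dim_at_most k [set: M].
  case: card => [fG|[cG ncK]].
    exact: (simple_module_finite_groupoid T_mul T_mul0 T_simple Tx1 fG).
  apply: (simple_module_finite_dim T_mul T_mul0 T_simple Tx1 fU cG ncK).
  by apply: VA; exact: grng_rng.
move=> f Af; apply: (@dim_at_most_finite _ _ k); last exact: dim_at_mostS Mk.
split; first by exists 0 => //; have := lin f Af (-1) 0 0; rewrite scaler0 addr0 scaleN1r addNr.
by move=> a _ _ [m _ <-] [m' _ <-]; exists (a *: m + m') => //; rewrite (lin f Af).
Qed.

(** What the size of [K] has to provide is that [K] is uncountable unless [G] is
finite. *)
Lemma locally_finite_CCR (K : closedFieldType) (G : groupoidTopType)
    (H : groupType) (c : G -> H) :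
  ample_Hausdorff_groupoid G -> @second_countable G ->
  (forall u : G, units G u -> virtually_abelian_isotropy u) ->
  cocycle c -> continuous (c : G -> discrete_topology H) ->
  locally_finite K c -> (countable [set: K] -> finite_set [set: G]) -> CCR K G.
Proof.
move=> [_ hG _ _ bG] [B cB [_ bB]] VA coc cc lf Kcard.
have oc h : open (c @^-1` [set h]).
  by have /continuousP := cc; apply; exact: discrete_open.
have fc h : finite_set (c @^-1` [set h]).
  have [k dk] := finite_dimensional_dim_at_most (lf h).
  apply: (ample_open_finite hG bG (oc h) dk) => U cU Uh.
  by apply: sub_linear_span; exists U.
have discG (x : G) : open [set x].
  pose X := c @^-1` [set c x].
  have -> : [set x] = X `&` ~` (X `\` [set x]).
    apply/seteqP; split=> [_ ->|y [Xy /not_andP[//|]]]; first by split=> // -[_]; apply.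
    exact: contrapT.
  apply: openI; first exact: oc.
  apply: closed_openC; apply: hausdorff_finite_closed => //.
  by apply: finite_setD; exact: fc.
apply: discrete_CCR => //.
  apply: sub_finite_set (fc 1%g) => u uu.
  have su : gsrc u = u by rewrite -uu gsrc_rng.
  have uM : gmul u u = u by rewrite -{1}uu gmul_rng.
  have := coc u u; rewrite uM su uu => /(_ erefl) cu.
  by apply: (mulgI (c u)); rewrite -cu mulg1.
have [/Kcard|ncK] := pselect (countable [set: K]); [by left|right; split=> //].
have single_inj : {in [set: G] &, injective (fun x : G => [set x])}.
  by move=> x y _ _ xy; have : [set y] x by rewrite -xy.
rewrite -(eq_countable (inj_card_eq single_inj)).
apply: sub_countable cB; apply: subset_card_le.
move=> _ [x _ <-]; have nx : nbhs x [set x] by exact: open_nbhs_nbhs.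
have [V [BV Vx] Vs] := bB x _ nx.
by rewrite (_ : [set x] = V) //; apply/seteqP; split => // _ ->.
Qed.

(** If [K] is countable, a basis smaller than [K] is finite. *)
Lemma dim_lt_countable_finite (K : fieldType) (G : groupoidTopType) :
  ample_Hausdorff_groupoid G -> dim_lt_card (steinberg_algebra K G) K ->
  countable [set: K] -> finite_set [set: G].
Proof.
move=> [_ hG _ _ bG] [B basB [_ nKB]] cK.
have fB : finite_set B.
  apply: contrapT => /infiniteP natB; apply: nKB; exact: card_le_trans cK natB.
have [k dk] : exists k, dim_at_most k (steinberg_algebra K G).
  by apply: finite_dimensional_dim_at_most; exists B.
apply: (ample_open_finite hG bG openT dk) => U cU _.
by apply: sub_linear_span; exists U.
Qed.

Lemma complex_uncountable (R : realType) : ~ countable [set: R[i]].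
Proof.
move=> /countable_injP[code cinj].
have cR : countable `[0%R, 1%R : R].
  apply/countable_injP; exists (fun x => code (x%:C)%C) => x y _ _ /cinj.
  by rewrite !in_setT => /(_ isT isT) [].
have := countable_lebesgue_measure0 cR.
rewrite lebesgue_measure_itv /= lte_fin ltr01 oppr0 adde0 => /eqP.
by rewrite eqe oner_eq0.
Qed.

Theorem proposition3p9 :
  (forall (G : groupoidTopType) (H : groupType) (K : closedFieldType)
      (c : G -> H),
    ample_Hausdorff_groupoid G ->
    @second_countable G ->
    (forall u : G, units G u -> virtually_abelian_isotropy u) ->
    dim_lt_card (steinberg_algebra K G) K ->
    cocycle c ->
    continuous (c : G -> discrete_topology H) ->
    locally_finite K c ->
    CCR K G)
  /\
  (forall (R : realType) (G : groupoidTopType) (H : groupType) (c : G -> H),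
    ample_Hausdorff_groupoid G ->
    @second_countable G ->
    (forall u : G, units G u -> virtually_abelian_isotropy u) ->
    cocycle c ->
    continuous (c : G -> discrete_topology H) ->
    locally_finite R[i] c ->
    CCR R[i] G).
Proof.
split=> [G H K c aG sc VA dK coc cc lf|R G H c aG sc VA coc cc lf].
  apply: (locally_finite_CCR aG sc VA coc cc lf).
  exact: dim_lt_countable_finite.
apply: (locally_finite_CCR aG sc VA coc cc lf).
by move=> cR; case: (complex_uncountable cR).
Qed.
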